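(* The interval $\mathbf{I}(W^{\infty})$ has continuum cardinality, i.e. $|\mathbf{I}(W^\infty)|=2^{\aleph_0}$.
   Context: $\Omega$ is the set of all Boolean functions $f\colon\{0,1\}^n\to\{0,1\}$, $n\ge 1$. An $m$-ary $g$ is a subfunction of an $n$-ary $f$ if there is a map $\sigma\colon\{1,\dots,n\}\to\{1,\dots,m\}$ with $g(x_1,\dots,x_m)=f(x_{\sigma(1)},\dots,x_{\sigma(n)})$ identically. An equational class is a set $\mathcal{K}\subseteq\Omega$ (possibly empty) such that every subfunction of a member of $\mathcal{K}$ is in $\mathcal{K}$. For an $n$-ary $f$ and $k$-ary $g_1,\dots,g_n$, the composition $f(g_1,\dots,g_n)$ is the $k$-ary function $\mathbf{a}\mapsto f(g_1(\mathbf{a}),\dots,g_n(\mathbf{a}))$; $\mathcal{K}$ is composition-closed if all compositions $f(g_1,\dots,g_n)$ with $f,g_1,\dots,g_n\in\mathcal{K}$ ($g_i$ of equal arity) belong to $\mathcal{K}$. A clone is a composition-closed subset of $\Omega$ containing all projections; $[\mathcal{K}]$ is the smallest clone containing $\mathcal{K}$. $\mathbf{I}$ is the set of all composition-closed equational classes, and $\mathbf{I}(\mathcal{C})=\{\mathcal{K}\in\mathbf{I}:[\mathcal{K}]=\mathcal{C}\}$ (an interval of the lattice $(\mathbf{I};\subseteq)$). An $n$-ary $f$ preserves a relation $P\subseteq\{0,1\}^k$ if applying $f$ coordinatewise to any $n$ members of $P$ gives a member of $P$. For finite $k\ge2$, $W^k$ is the clone of functions preserving $\{0,1\}^k\setminus\{\mathbf{0}\}$,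 where $\mathbf{0}=(0,\dots,0)$; $W^\infty=\bigcap_{k\ge2}W^k$, which is the clone generated by implication. *)

(* Defs.v *)
From mathcomp Require Import all_boot all_order.
From mathcomp Require Import mathcomp_extra boolp classical_sets functions cardinality.

Set Implicit Arguments.
Unset Strict Implicit.
Unset Printing Implicit Defensive.

Local Open Scope classical_set_scope.

Definition bvec (n : nat) := {ffun 'I_n -> bool}.

Definition boolfun (n : nat) := {ffun bvec n -> bool}.

(* Arities are positive: the tag [n] of an element of [Omega] stands for the
   arity [n.+1]. *)
Definition Omega := {n : nat & boolfun n.+1}.

Definition fn (n : nat) (f : boolfun n.+1) : Omega :=
  existT (fun m => boolfun m.+1) n f.

Definition subfunction (m n : nat) (g : boolfun m) (f : boolfun n) : Prop :=
  exists sigma : 'I_n -> 'I_m,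
    forall x : bvec m, g x = f [ffun i => x (sigma i)].

Definition equational_class (K : set Omega) : Prop :=
  forall (m n : nat) (g : boolfun m.+1) (f : boolfun n.+1),
    K (fn f) -> subfunction g f -> K (fn g).

Definition composition (n k : nat) (f : boolfun n) (g : 'I_n -> boolfun k) :
    boolfun k :=
  [ffun a : bvec k => f [ffun i => g i a]].

Definition composition_closed (K : set Omega) : Prop :=
  forall (n k : nat) (f : boolfun n.+1) (g : 'I_n.+1 -> boolfun k.+1),
    K (fn f) -> (forall i, K (fn (g i))) -> K (fn (composition f g)).

Definition projection (n : nat) (i : 'I_n) : boolfun n :=
  [ffun x : bvec n => x i].

Definition clone (K : set Omega) : Prop :=
  composition_closed K /\
  forall (n : nat) (i : 'I_n.+1), K (fn (projection i)).

Definition generated_clone (K : set Omega) : set Omega := smallest clone K.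

Definition II : set (set Omega) :=
  [set K | equational_class K /\ composition_closed K].

Definition clone_interval (C : set Omega) : set (set Omega) :=
  [set K | II K /\ generated_clone K = C].

Definition preserves (n k : nat) (f : boolfun n) (P : set (bvec k)) : Prop :=
  forall p : 'I_n -> bvec k,
    (forall i, P (p i)) -> P [ffun j => f [ffun i => p i j]].

Definition W (k : nat) : set Omega :=
  [set f : Omega | preserves (projT2 f) [set~ ([ffun=> false] : bvec k)]].

Definition Winf : set Omega := \bigcap_(k in [set k | 2 <= k]) W k.

(* Main.v *)
Require Import Defs.
From mathcomp Require Import all_boot all_order.
From mathcomp Require Import mathcomp_extra boolp classical_sets functions cardinality.

Set Implicit Arguments.
Unset Strict Implicit.
Unset Printing Implicit Defensive.

Local Open Scope classical_set_scope.
Local Open Scope card_scope.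

(** The upper bound holds because [Omega] is countable, so it has only
continuum many subsets ([card_set_countType]).

For the lower bound, [Winf] consists of the functions that lie pointwise above
one of their variables ([WinfP]). If such an [f], above [x i], is composed with
functions [g], the result is above [g i]. Hence inside [Winf] closure under
composition comes for free from closure under going up pointwise
([upclass_composition]): for any [G] contained in [Winf], the functions above a
subfunction of a member of [G] form a class [upclass G] in [II]. That class
generates [Winf] as soon as [G] contains implication. Indeed, if [f] is above
[x i], then [u -> f x] is above the subfunction [u -> x i] of implication, and
[f] is recovered by substituting the constant [true] for [u]
([Winf_generated]).

It remains to find infinitely many members of [Winf] that are independent for
the quasi-order [minorized] of being above a subfunction, none of them above a
subfunction of implication. The function [star n] vanishes exactly at the
points with two zeros, one of which is at coordinate [0]; the zero sets are
thus the edges of a star with centre [0] and [n + 2] leaves. A substitution of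
variables that witnesses [minorized (star m) (star n)] pulls edges back to
edges, which forces it to be a bijection of the vertices, so that [m = n]
([star_antichain]). Implication needs a coordinate equal to [1] at every zero
of the function above it, and the zeros of [star m] have no such coordinate
([star_not_above_imp]). Adjoining to implication the functions [star n] with
[n] in [S] therefore gives distinct classes for distinct [S]. *)

(** The zeros of a function in [Winf] all vanish at one common coordinate.
Otherwise choosing for each coordinate [i] a zero that is [true] at [i] gives
finitely many zeros, whose columns are nonzero vectors mapped to the zero
vector. *)
Lemma WinfP (n : nat) (f : boolfun n.+1) :
  Winf (fn f) <-> exists i, forall x : bvec n.+1, x i -> f x.
Proof.
split=> [Wf | [i fi] k _ p p_neq0]; last first.
  move=> /ffunP out0; apply: (p_neq0 i); apply/ffunP => j.
  have := out0 j; rewrite !ffunE; apply: contraFF => pij.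
  by apply: fi; rewrite ffunE.
apply: contrapT => no_coord.
have /choice[a aP] : forall i, exists x : bvec n.+1, x i /\ ~~ f x.
  move=> i; apply: contrapT => noa; apply: no_coord; exists i => x xi.
  by apply: contrapT => /negP fx; apply: noa; exists x.
(* There are only [n.+1] chosen zeros; the length [n.+2], with the zero of
   index [0] repeated, meets the requirement of length at least [2]. *)
apply: (Wf n.+2 _ (fun i => [ffun j : 'I_n.+2 => a (inord j) i])) => //=.
  move=> i /ffunP/(_ (inord i)); rewrite !ffunE inordK ?inord_val; last first.
    exact/leqW/ltn_ord.
  by have [->] := aP i.
apply/ffunP => j; rewrite !ffunE; apply/negbTE.
have [_] := aP (inord j); congr (~~ f _).
by apply/ffunP => i; rewrite !ffunE.
Qed.

Definition minorized (m n : nat) (h : boolfun m) (f : boolfun n) : Prop :=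
  exists sigma : 'I_n -> 'I_m,
    forall x : bvec m, f [ffun i => x (sigma i)] -> h x.

Definition upclass (G : set Omega) : set Omega :=
  [set h : Omega | exists2 f : Omega, G f & minorized (projT2 h) (projT2 f)].

Lemma minorized_refl (n : nat) (f : boolfun n) : minorized f f.
Proof.
by exists id => x; congr (is_true (f _)); apply/ffunP => i; rewrite ffunE.
Qed.

Lemma upclass_subfunction (G : set Omega) : equational_class (upclass G).
Proof.
move=> m n g h [f Gf [sigma sigmaP]] [tau tauP]; exists f => //.
exists (tau \o sigma) => x /= fx; rewrite tauP; apply: sigmaP.
by congr (is_true (projT2 f _)): fx; apply/ffunP => i; rewrite !ffunE.
Qed.

Lemma upclass_sub_Winf (G : set Omega) : G `<=` Winf -> upclass G `<=` Winf.
Proof.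
move=> GW [m h] [[n f] /GW/WinfP[i fi] [sigma sigmaP]].
by apply/WinfP; exists (sigma i) => x xi; apply: sigmaP; apply: fi; rewrite ffunE.
Qed.

(** If [f] is above [x i] then [composition f g] is above [g i], whatever the
other [g j] are, so it is above every subfunction that [g i] is above. *)
Lemma upclass_composition (G : set Omega) :
  G `<=` Winf -> composition_closed (upclass G).
Proof.
move=> GW n k f g /(upclass_sub_Winf GW)/WinfP[i fi] Kg.
have [h Gh [sigma sigmaP]] := Kg i; exists h => //; exists sigma => x hx.
by rewrite ffunE; apply: fi; rewrite ffunE; apply: sigmaP.
Qed.

Lemma upclass_II (G : set Omega) : G `<=` Winf -> II (upclass G).
Proof.
by split; [exact: upclass_subfunction | exact: upclass_composition].
Qed.

Lemma Winf_clone : clone Winf.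
Proof.
split=> [n k f g /WinfP[i fi] Wg | n i].
  have /WinfP[j gj] := Wg i; apply/WinfP; exists j => x xj.
  by rewrite ffunE; apply: fi; rewrite ffunE; apply: gj.
by apply/WinfP; exists i => x; rewrite ffunE.
Qed.

Definition imp : boolfun 2 := [ffun x : bvec 2 => x ord0 ==> x ord_max].

Lemma Winf_imp : Winf (fn imp).
Proof. by apply/WinfP; exists ord_max => x xi; rewrite ffunE xi implybT. Qed.

(** The clone provides the bare variables that compositions inside [K] lack: [f]
is the composition of [u -> f x] with the constant [true] and projections, and
both [u -> f x] and [true] are above subfunctions of implication, namely
[u -> x i] and [x -> x]. *)
Lemma Winf_generated (K : set Omega) :
  upclass [set fn imp] `<=` K -> Winf `<=` generated_clone K.
Proof.
move=> impK [n f] /WinfP[i fi] C [[Ccomp Cproj] KC].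
pose F : boolfun n.+2 :=
  [ffun x : bvec n.+2 => x ord0 ==> f [ffun j => x (lift ord0 j)]].
pose one : boolfun n.+1 := [ffun => true].
have CF : C (fn F).
  apply/KC/impK; exists (fn imp) => //.
  exists (fun j => if j == ord0 then ord0 else lift ord0 i) => x /=.
  rewrite !ffunE /=; case: (x ord0) => //= xi.
  by apply: fi; rewrite ffunE.
have C1 : C (fn one).
  apply/KC/impK; exists (fn imp) => //.
  by exists (fun=> ord0) => x _; rewrite ffunE.
pose g (j : 'I_n.+2) : boolfun n.+1 :=
  if unlift ord0 j is Some k then projection k else one.
have -> : existT _ n f = fn (composition F g).
  congr (existT _ n _); apply/ffunP => x; rewrite !ffunE /g unlift_none ffunE /=.
  by congr (f _); apply/ffunP => j; rewrite !ffunE liftK ffunE.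
apply: Ccomp => // j; rewrite /g; case: unlift => [k|] //; exact: Cproj.
Qed.

Lemma upclass_interval (G : set Omega) :
  G `<=` Winf -> G (fn imp) -> clone_interval Winf (upclass G).
Proof.
move=> GW Gimp; split; first exact: upclass_II.
apply/seteqP; split.
  apply: smallest_sub; [exact: Winf_clone | exact: upclass_sub_Winf].
by apply: Winf_generated => h [f -> hf]; exists (fn imp).
Qed.

Definition two_zeros (n : nat) (j : 'I_n.+1) : bvec n.+1 :=
  [ffun i => (i != ord0) && (i != j)].

(** The arity [n.+3] leaves at least two leaves: with two edges the centre of the
star is determined by the edges, which [star_antichain] relies on. *)
Definition star (n : nat) : boolfun n.+3 :=
  [ffun x : bvec n.+3 => ~~ [exists j, (j != ord0) && (x == two_zeros j)]].

Lemma star_two_zeros (n : nat) (j : 'I_n.+3) :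
  j != ord0 -> star n (two_zeros j) = false.
Proof.
move=> j0; rewrite ffunE; apply/negbTE; rewrite negbK.
by apply/existsP; exists j; rewrite j0 eqxx.
Qed.

Lemma Winf_star (n : nat) : Winf (fn (star n)).
Proof.
apply/WinfP; exists ord0 => x x0; rewrite ffunE.
by apply/existsP => -[j /andP[_ /eqP xj]]; move: x0; rewrite xj ffunE.
Qed.

(** A witness [sigma] would make [sigma ord0] a coordinate at which all zeros of
[star m] are [true], but each coordinate is a zero of some [two_zeros j]. *)
Lemma star_not_above_imp (m : nat) : ~ minorized (star m) imp.
Proof.
case=> sigma sigmaP.
have two j : j != ord0 -> (sigma ord0 != ord0) && (sigma ord0 != j).
  move=> j0; apply: contraT => s0j; have := sigmaP (two_zeros j).
  by rewrite (star_two_zeros j0) !ffunE (negbTE s0j) => /(_ isT).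
have /andP[s0 _] := two ord_max isT.
by have := two _ s0; rewrite eqxx andbF.
Qed.

(** A witness [sigma] maps the vertices of the second star to those of the first
so that the preimage of every edge [{0, j}] is an edge [{0, k}]. The centre
lies in all these preimages, hence is sent into the intersection of the edges,
which is the centre. No leaf [i] is sent to the centre: the preimage of any edge
would contain [0] and [i], hence nothing else, and a second leaf would have no
possible image. So each leaf of the first star has exactly one preimage, a
leaf. *)
Lemma star_antichain (m n : nat) : minorized (star m) (star n) -> m = n.
Proof.
case=> sigma sigmaP.
(* [two_zeros j] composed with [sigma] is again a zero: [two_zeros k]. *)
have match_zero (j : 'I_m.+3) : j != ord0 ->
    exists2 k : 'I_n.+3, k != ord0 & forall i,
      (sigma i != ord0) && (sigma i != j) = (i != ord0) && (i != k).
  move=> j0; have : ~~ star n [ffun i => two_zeros j (sigma i)].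
    by apply/negP => /sigmaP; rewrite star_two_zeros.
  rewrite ffunE negbK => /existsP[k /andP[k0 /eqP/ffunP kP]].
  by exists k => // i; have := kP i; rewrite !ffunE.
have s0 : sigma ord0 = ord0.
  apply/eqP; apply: contraT => s0; pose j : 'I_m.+3 := inord 1.
  pose j' : 'I_m.+3 := inord 2.
  have j0 : j != ord0 by rewrite -val_eqE /= inordK.
  have j'0 : j' != ord0 by rewrite -val_eqE /= inordK.
  have [k _ /(_ ord0)] := match_zero j j0.
  have [k' _ /(_ ord0)] := match_zero j' j'0.
  rewrite s0 /= => /negbFE/eqP -> /negbFE/eqP/(congr1 val).
  by rewrite /= !inordK.
have s_neq0 i : i != ord0 -> sigma i != ord0.
  move=> i0; apply/eqP => si0.
  have [i' i'0 i'i] : exists2 i' : 'I_n.+3, i' != ord0 & i' != i.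
    case: (eqVneq i ord_max) => [->|]; last by exists ord_max; rewrite // eq_sym.
    by exists (inord 1); rewrite -val_eqE /= inordK.
  case: (eqVneq (sigma i') ord0) => si'.
    have [k _ kP] := match_zero ord_max isT.
    have := kP i; rewrite si0 i0 /= => /esym/negbFE/eqP ik.
    by have := kP i'; rewrite si' i'0 /= -ik i'i.
  have [k _ kP] := match_zero _ si'.
  have := kP i; rewrite si0 i0 /= => /esym/negbFE/eqP ik.
  by have := kP i'; rewrite eqxx andbF i'0 -ik i'i.
have sigma_inj : injective sigma.
  move=> i i' sii'.
  case: (eqVneq i ord0) => [i0|i0]; case: (eqVneq i' ord0) => [i'0|i'0].
  - by rewrite i0 i'0.
  - by have := s_neq0 _ i'0; rewrite -sii' i0 s0.
  - by have := s_neq0 _ i0; rewrite sii' i'0 s0.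
  have [k _ kP] := match_zero _ (s_neq0 _ i0).
  have := kP i; have := kP i'; rewrite -sii' eqxx andbF i0 i'0 /=.
  by move=> /esym/negbFE/eqP -> /esym/negbFE/eqP ->.
have /fin_all_exists[tau tauK] (j : 'I_m.+3) : exists i, sigma i = j.
  case: (eqVneq j ord0) => [->|j0]; first by exists ord0.
  have [k k0 kP] := match_zero j j0; exists k; have := kP k.
  by rewrite (s_neq0 _ k0) eqxx andbF /= => /negbFE/eqP.
have := leq_card _ sigma_inj; have := leq_card _ (can_inj tauK).
by rewrite !card_ord !ltnS => mn nm; apply/eqP; rewrite eqn_leq mn.
Qed.

Definition star_class (S : nat -> bool) : set Omega :=
  upclass [set h | h = fn imp \/ exists2 n, S n & h = fn (star n)].

Lemma star_class_interval (S : nat -> bool) :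
  clone_interval Winf (star_class S).
Proof.
apply: upclass_interval; last by left.
by move=> h [->|[n _ ->]]; [exact: Winf_imp | exact: Winf_star].
Qed.

Lemma star_classP (S : nat -> bool) (n : nat) :
  star_class S (fn (star n)) <-> S n.
Proof.
split=> [[f [->|[m Sm ->]]]|Sn].
- by move=> /star_not_above_imp.
- by move=> /star_antichain ->.
by exists (fn (star n)); [right; exists n | exact: minorized_refl].
Qed.

Lemma card_set_countType (T : countType) :
  [set: set T] #<= [set: nat -> bool].
Proof.
apply/pcard_injP.
exists (fun K i => `[< exists2 w, pickle w = i & K w >]) => K L _ _ KL.
apply/funext => w; apply/propext.
have mem_code (M : set T) : `[< exists2 v, pickle v = pickle w & M v >] <-> M w.
  split=> [/asboolP[v /(pcan_inj (@pickleK T)) ->] //|Mw].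
  by apply/asboolP; exists w.
by rewrite -(mem_code K) -(mem_code L) (congr1 (@^~ (pickle w)) KL).
Qed.

Theorem theorem5p6 : clone_interval Winf #= [set: nat -> bool].
Proof.
rewrite card_eq_le; apply/andP; split.
  exact: card_le_trans (subset_card_le (@subsetT _ _)) (card_set_countType _).
have star_class_inj : {in [set: nat -> bool] &, injective star_class}.
  move=> S T _ _ ST; apply/funext => n; apply/idP/idP => Hn.
    by apply/star_classP; rewrite -ST; apply/star_classP.
  by apply/star_classP; rewrite ST; apply/star_classP.
rewrite -(card_le_eql (inj_card_eq star_class_inj)).
by apply: subset_card_le => _ [S _ <-]; exact: star_class_interval.
Qed.
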